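(* Let $\mathbf{X}\in\mathbb{R}^{N\times p}$ with $N>p$ have rows $\mathbf{x}_1^T,\dots,\mathbf{x}_N^T$, let $\mathbf{y}\in\mathbb{R}^N$, and take the partition of the data into singletons, $\mathcal{D}_i=\{\mathbf{x}_i\}$ for all $i\in\{1,\dots,N\}$. Let $\tilde{\mathbf{S}}$ (the leverage score sketching matrix) and $\hat{\mathbf{S}}$ (the weighted compression matrix), as defined in the context, be constructed from the same random draws with replacement, the total number of draws being $r=\sum_{i=1}^k\mathbf{w}_i$, where $k$ is the number of distinct indices drawn and $\mathbf{w}_i$ is the number of times the $i$-th distinct index was drawn. Then for every $\theta\in\mathbb{R}^p$, $$\nabla_\theta L_{\mathrm{S}}(\tilde{\mathbf{S}},\mathbf{X},\mathbf{y};\theta)=\nabla_\theta L_{\mathrm{S}}(\hat{\mathbf{S}},\mathbf{X},\mathbf{y};\theta),$$ and this remains true after any permutation of the rows of $\tilde{\mathbf{S}}$ or of $\hat{\mathbf{S}}$.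
   Context: For a matrix $\mathbf{S}$ with $N$ columns, the sketched least squares loss is $L_{\mathrm{S}}(\mathbf{S},\mathbf{X},\mathbf{y};\theta)=\sum_i\big((\mathbf{S}\mathbf{X}\theta)_i-(\mathbf{S}\mathbf{y})_i\big)^2$, the sum being over all rows $i$ of $\mathbf{S}$. The leverage scores of $\mathbf{X}$ are $\ell_i=(\mathbf{X}\mathbf{X}^\dagger)_{ii}$, where $\mathbf{X}^\dagger$ is the Moore-Penrose pseudoinverse, and $\pi_i=\ell_i/\sum_{j=1}^N\ell_j$ is the sampling probability of row $i$. For singleton parts, the part probability is $\Pi_i=\pi_i$. Draws: indices $t_1,\dots,t_r\in\{1,\dots,N\}$ are drawn with replacement according to $\{\pi_i\}$ (so every drawn index has positive probability). Let $j_1,\dots,j_k$ be the distinct indices among them, and let $\mathbf{w}_i$ be the number of times $j_i$ occurs among $t_1,\dots,t_r$. Leverage score sketching matrix: $\tilde{\mathbf{S}}\in\mathbb{R}^{r\times N}$ has as its $m$-th row $\frac{1}{\sqrt{r\pi_{t_m}}}\mathbf{e}_{t_m}^T$, $m=1,\dots,r$, where $\mathbf{e}_t$ is the $t$-th standard basis vector of $\mathbb{R}^N$. Weighted compression matrix: $\mathbf{S}_{\mathrm{p}}\in\mathbb{R}^{k\times N}$ has as its $i$-th row $\frac{1}{\sqrt{r\Pi_{j_i}}}\mathbf{e}_{j_i}^T$, $i=1,\dots,k$ (each drawn index is kept only once), and $\hat{\mathbf{S}}=\sqrt{\mathbf{W}}\,\mathbf{S}_{\mathrm{p}}$ with $\mathbf{W}=\mathrm{diag}(\mathbf{w}_1,\dots,\mathbf{w}_k)$.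 *)

(* Defs.v *)
From HB Require Import structures.
From mathcomp Require Import all_boot all_order all_algebra all_fingroup.
From mathcomp Require Import all_classical all_reals all_analysis.

Set Implicit Arguments.
Unset Strict Implicit.
Unset Printing Implicit Defensive.

Import Order.TTheory GRing.Theory Num.Theory.
Import numFieldNormedType.Exports.

Local Open Scope ring_scope.

Section MoorePenrose.
Context {R : realFieldType}.

Definition is_pseudoinverse (m n : nat) (A : 'M[R]_(m, n)) (B : 'M[R]_(n, m)) :=
  [/\ A *m B *m A = A,
      B *m A *m B = B,
      (A *m B)^T = A *m B
    & (B *m A)^T = B *m A].

(* Not [pinvmx], which is only a generalised inverse on the row space: it does
   not satisfy the symmetry conditions in general. *)
Definition pseudoinverse (m n : nat) (A : 'M[R]_(m, n)) : 'M[R]_(n, m) :=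
  xget 0 [set B | is_pseudoinverse A B].

Lemma pseudoinverse_unique (m n : nat) (A : 'M[R]_(m, n)) (B C : 'M[R]_(n, m)) :
  is_pseudoinverse A B -> is_pseudoinverse A C -> B = C.
Proof.
move=> [ABA BAB ABt BAt] [ACA CAC ACt CAt].
have AB_AC : A *m B = A *m C.
  have e : (A *m C) *m (A *m B) = A *m B by rewrite mulmxA ACA.
  rewrite -ABt -e trmx_mul ABt ACt mulmxA ABA //.
have BA_CA : B *m A = C *m A.
  have e : (B *m A) *m (C *m A) = B *m A by rewrite -mulmxA (mulmxA A) ACA.
  rewrite -BAt -e trmx_mul BAt CAt -mulmxA (mulmxA A) ABA //.
by rewrite -BAB BA_CA -mulmxA AB_AC mulmxA CAC.
Qed.

Lemma gram_unitmx (m n : nat) (F : 'M[R]_(m, n)) :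
  row_free F -> F *m F^T \in unitmx.
Proof.
move=> freeF; rewrite -row_free_unit -kermx_eq0; apply/rowV0P => u.
move=> /sub_kermxP uFF0.
have uF0 : u *m F = 0.
  have : (u *m F) *m (u *m F)^T = 0.
    by rewrite trmx_mul mulmxA -(mulmxA u) uFF0 mul0mx.
  move=> /matrixP/(_ 0 0); rewrite !mxE => /eqP.
  rewrite psumr_eq0 => [/allP h|i _]; last by rewrite [_^T _ _]mxE -expr2 sqr_ge0.
  apply/matrixP => i l; rewrite [i]ord1 [RHS]mxE; apply/eqP.
  by have := h l (mem_index_enum _); rewrite [_^T _ _]mxE /= mulf_eq0 orbb.
by apply: (row_free_inj freeF); rewrite uF0 mul0mx.
Qed.

Lemma pseudoinverse_exists (m n : nat) (A : 'M[R]_(m, n)) :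
  exists B, is_pseudoinverse A B.
Proof.
move: (\rank A) (col_base A) (row_base A) (mulmx_base A) (col_base_full A)
  (row_base_free A) => q C F AE fullC freeF.
have uF : F *m F^T \in unitmx by apply: gram_unitmx.
have uC : C^T *m C \in unitmx.
  by rewrite -{2}[C]trmxK; apply: gram_unitmx; rewrite /row_free mxrank_tr.
set GF := invmx (F *m F^T); set GC := invmx (C^T *m C).
have GFt : GF^T = GF by rewrite /GF trmx_inv trmx_mul trmxK.
have GCt : GC^T = GC by rewrite /GC trmx_inv trmx_mul trmxK.
pose B := F^T *m GF *m GC *m C^T.
have AB : A *m B = C *m GC *m C^T.
  rewrite -AE /B -!mulmxA; congr (_ *m _).
  by rewrite (mulmxA F) (mulmxA _ GF) mulmxV // mul1mx.
have BA : B *m A = F^T *m GF *m F.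
  rewrite -AE /B -!mulmxA; do 2!congr (_ *m _).
  by rewrite (mulmxA C^T) mulmxA mulVmx // mul1mx.
exists B; split.
- by rewrite AB -AE -!mulmxA (mulmxA C^T) (mulmxA GC) mulVmx // mul1mx.
- rewrite BA /B -!mulmxA; congr (_ *m _).
  by rewrite (mulmxA F) (mulmxA _ GF) mulmxV // mul1mx.
- by rewrite AB !trmx_mul trmxK GCt mulmxA.
- by rewrite BA !trmx_mul trmxK GFt mulmxA.
Qed.

Lemma pseudoinverseP (m n : nat) (A : 'M[R]_(m, n)) :
  is_pseudoinverse A (pseudoinverse A).
Proof.
rewrite /pseudoinverse; case: xgetP => // noB.
by have [B /noB] := pseudoinverse_exists A.
Qed.

End MoorePenrose.

Section Sketching.
Context {R : realType}.

Definition leverage_score (N p : nat) (X : 'M[R]_(N, p)) (i : 'I_N) : R :=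
  (X *m pseudoinverse X) i i.

Definition sampling_prob (N p : nat) (X : 'M[R]_(N, p)) (i : 'I_N) : R :=
  leverage_score X i / \sum_(l < N) leverage_score X l.

(* With the partition into the singletons [{x_i}], the part of index [i]
   consists of row [i] only, so parts are indexed by ['I_N] too. *)
Definition singleton_part_prob (N p : nat) (X : 'M[R]_(N, p)) (i : 'I_N) : R :=
  sampling_prob X i.

Definition sketched_loss (m N p : nat) (S : 'M[R]_(m, N)) (X : 'M[R]_(N, p))
    (y : 'cV[R]_N) (theta : 'cV[R]_p) : R :=
  \sum_(i < m) ((S *m X *m theta) i 0 - (S *m y) i 0) ^+ 2.

Definition gradient (p : nat) (f : 'cV[R]_p -> R) (theta : 'cV[R]_p) : 'cV[R]_p :=
  \col_(i < p) 'D_(delta_mx i 0) f theta.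

(* [t] is the sequence of draws; [j] enumerates, in any order and without
   repetition, the indices occurring in [t]. *)
Definition distinct_draws (N r k : nat) (t : 'I_r -> 'I_N) (j : 'I_k -> 'I_N) :=
  injective j /\ codom j =i codom t.

Definition draw_count (N r k : nat) (t : 'I_r -> 'I_N) (j : 'I_k -> 'I_N)
    (i : 'I_k) : nat :=
  #|[set m : 'I_r | t m == j i]|.

Definition leverage_sketch (N p r : nat) (X : 'M[R]_(N, p)) (t : 'I_r -> 'I_N) :
    'M[R]_(r, N) :=
  \matrix_(m < r) ((Num.sqrt (r%:R * sampling_prob X (t m)))^-1
                     *: delta_mx 0 (t m)).

Definition compression_matrix (N p k : nat) (X : 'M[R]_(N, p)) (r : nat)
    (j : 'I_k -> 'I_N) : 'M[R]_(k, N) :=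
  \matrix_(i < k) ((Num.sqrt (r%:R * singleton_part_prob X (j i)))^-1
                     *: delta_mx 0 (j i)).

Definition weight_matrix (k : nat) (w : 'I_k -> nat) : 'M[R]_k :=
  diag_mx (\row_(i < k) (w i)%:R).

(* [weight_matrix w] is diagonal with nonnegative entries, so its square root
   is taken entrywise. *)
Definition weighted_compression (N p k : nat) (X : 'M[R]_(N, p)) (r : nat)
    (j : 'I_k -> 'I_N) (w : 'I_k -> nat) : 'M[R]_(k, N) :=
  map_mx Num.sqrt (weight_matrix w) *m compression_matrix X r j.

Lemma sum_draw_count (N r k : nat) (t : 'I_r -> 'I_N) (j : 'I_k -> 'I_N) :
  distinct_draws t j -> (\sum_(i < k) draw_count t j i)%N = r.
Proof.
move=> [inj_j jt].
under eq_bigr do rewrite /draw_count -sum1dep_card.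
rewrite (exchange_big_dep predT) //= -[RHS]card_ord -sum1_card.
apply: eq_bigr => m _.
have /codomP[i tm] : t m \in codom j by rewrite jt codom_f.
by rewrite (bigD1 i) ?tm //= big1 // => l /andP[/eqP /inj_j -> /eqP].
Qed.

Lemma differentiable_sketched_loss (m N p : nat) (S : 'M[R]_(m, N))
    (X : 'M[R]_(N, p)) (y : 'cV[R]_N) (theta : 'cV[R]_p) :
  differentiable (sketched_loss S X y) theta.
Proof.
pose g i := fun th : 'cV[R]_p =>
  \sum_(l < p) (S *m X) i l *: (th l 0 : R) - (S *m y) i 0.
have -> : sketched_loss S X y = \sum_(i < m) (g i * g i).
  apply/funext => th; rewrite /sketched_loss fct_sumE; apply: eq_bigr => i _.
  by rewrite [(S *m X *m th) i 0]mxE expr2.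
apply: differentiable_sum => i.
suff dg : differentiable (g i) theta by exact: differentiableM.
apply: differentiableB; last exact: differentiable_cst.
rewrite (_ : (fun _ => _) =
  \sum_(l < p) (S *m X) i l *: (fun th : 'cV[R]_p => th l 0 : R)).
  apply: differentiable_sum => l; apply: differentiableZ.
  exact: differentiable_coord.
by apply/funext => th; rewrite fct_sumE.
Qed.

End Sketching.

(* Main.v *)
(* The two losses are already equal as functions of [theta]: with the residual
   [v = X theta - y], the sketch [S_lev] gives the sum over all draws [m] of
   [v_(t m)^2 / (r pi_(t m))], and grouping the draws with the same index [j i]
   gives the weighted sum for [S_wgt]. *)

Require Import Defs.
From HB Require Import structures.
From mathcomp Require Import all_boot all_order all_algebra all_fingroup.
From mathcomp Require Import all_classical all_reals all_analysis.

Set Implicit Arguments.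
Unset Strict Implicit.
Unset Printing Implicit Defensive.

Import Order.TTheory GRing.Theory Num.Theory.
Import numFieldNormedType.Exports.

Local Open Scope ring_scope.

Lemma sketched_loss_residual (R : realType) (m N p : nat) (S : 'M[R]_(m, N))
    (X : 'M[R]_(N, p)) (y : 'cV[R]_N) (theta : 'cV[R]_p) :
  sketched_loss S X y theta = \sum_i ((S *m (X *m theta - y)) i 0) ^+ 2.
Proof.
by apply: eq_bigr => i _; rewrite mulmxBr mulmxA [in RHS]mxE [in RHS](mxE _ (- _)).
Qed.

(** A row permutation only reindexes the sum of squared residuals. Since the equality is one of
    functions, it passes to gradients without any computation of derivatives. *)
Lemma sketched_loss_row_perm (R : realType) (m N p : nat) (s : 'S_m)
    (S : 'M[R]_(m, N)) (X : 'M[R]_(N, p)) (y : 'cV[R]_N) :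
  sketched_loss (row_perm s S) X y = sketched_loss S X y.
Proof.
apply/funext => theta; rewrite !sketched_loss_residual.
rewrite [RHS](reindex_inj (@perm_inj _ s)); apply: eq_bigr => i _.
by rewrite !mxE; congr (_ ^+ 2); apply: eq_bigr => l _; rewrite mxE.
Qed.

Lemma mul_scaled_delta_rows (R : pzRingType) (m n : nat) (a : 'I_m -> R)
    (f : 'I_m -> 'I_n) (v : 'cV[R]_n) (i : 'I_m) :
  (\matrix_(i < m) (a i *: delta_mx 0 (f i)) *m v) i 0 = a i * v (f i) 0.
Proof.
rewrite mxE (bigD1 (f i)) //= big1 => [|l /negPf l_neq].
  by rewrite !mxE !eqxx mulr1 addr0.
by rewrite !mxE l_neq andbF mulr0 mul0r.
Qed.

(** The entrywise root stays diagonal because [Num.sqrt] sends the off-diagonal zeros to zero. *)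
Lemma map_sqrt_weight_matrix (R : realType) (k : nat) (w : 'I_k -> nat) :
  map_mx Num.sqrt (weight_matrix w)
    = diag_mx (\row_i Num.sqrt (w i)%:R) :> 'M[R]_k.
Proof.
apply/matrixP => i l; rewrite !mxE.
by case: eqP => _; rewrite ?mulr1n // !mulr0n sqrtr0.
Qed.

(** Double counting of the pairs [(i, m)] with [t m = j i]: for fixed [i] there are
    [draw_count t j i] of them, for fixed [m] exactly one. *)
Lemma sum_over_draws (V : nmodType) (N r k : nat) (t : 'I_r -> 'I_N)
    (j : 'I_k -> 'I_N) (F : 'I_N -> V) :
  distinct_draws t j ->
  \sum_m F (t m) = \sum_i F (j i) *+ draw_count t j i.
Proof.
move=> [inj_j jt].
transitivity (\sum_i \sum_(m | t m == j i) F (t m)); last first.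
  apply: eq_bigr => i _; rewrite /draw_count -sumr_const.
  by apply: eq_big => [m|m /eqP -> //]; rewrite inE.
rewrite (exchange_big_dep predT) //=; apply: eq_bigr => m _.
(* The equality of codomains provides an [i] with [t m = j i]; injectivity of [j] makes it the only
   one, so the inner sum collapses. *)
have /codomP[i tm] : t m \in codom j by rewrite jt codom_f.
by rewrite (big_pred1 i) // => l; rewrite /= tm (inj_eq inj_j) eq_sym.
Qed.

Lemma sketched_loss_leverage_weighted (R : realType) (N p : nat)
    (X : 'M[R]_(N, p)) (y : 'cV[R]_N) (r k : nat) (t : 'I_r -> 'I_N)
    (j : 'I_k -> 'I_N) :
  distinct_draws t j ->
  sketched_loss (leverage_sketch X t) X y
    = sketched_loss (weighted_compression X r j (draw_count t j)) X y.
Proof.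
move=> tj; apply/funext => theta; rewrite !sketched_loss_residual.
set v := X *m theta - y.
(* This scale depends on the drawn index alone, so repeated draws contribute equal terms. *)
pose c l := (Num.sqrt (r%:R * sampling_prob X l))^-1.
under eq_bigr do rewrite mul_scaled_delta_rows.
rewrite (sum_over_draws (fun l => (c l * v l 0) ^+ 2) tj).
apply: eq_bigr => i _.
rewrite /weighted_compression map_sqrt_weight_matrix -mulmxA mul_diag_mx.
rewrite [in RHS]mxE mul_scaled_delta_rows [X in _ = (X * _) ^+ 2]mxE.
(* Squaring turns the root of the multiplicity back into the multiplicity. The scales of the two
   sketches agree by conversion, as [singleton_part_prob] unfolds to [sampling_prob]. *)
by rewrite -[LHS]mulr_natl [RHS]exprMn sqr_sqrtr ?ler0n.
Qed.

Theorem theorem5p1 (R : realType) (N p : nat) (ltpN : (p < N)%N)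
    (X : 'M[R]_(N, p)) (y : 'cV[R]_N)
    (r : nat) (t : 'I_r -> 'I_N) (t_gt0 : forall m, 0 < sampling_prob X (t m))
    (k : nat) (j : 'I_k -> 'I_N) (tj : distinct_draws t j) :
  let S_lev := leverage_sketch X t in
  let S_wgt := weighted_compression X r j (draw_count t j) in
  forall theta : 'cV[R]_p,
    gradient (sketched_loss S_lev X y) theta
      = gradient (sketched_loss S_wgt X y) theta
    /\ forall (s1 : 'S_r) (s2 : 'S_k),
         gradient (sketched_loss (row_perm s1 S_lev) X y) theta
           = gradient (sketched_loss (row_perm s2 S_wgt) X y) theta.
Proof.
move=> S_lev S_wgt theta.
have loss_eq : sketched_loss S_lev X y = sketched_loss S_wgt X y.
  exact: sketched_loss_leverage_weighted.
by split=> [|s1 s2]; rewrite ?sketched_loss_row_perm loss_eq.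
Qed.
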